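(* Let $\lambda=\lambda_j$ be a simple eigenvalue and let $\delta_2,\Lambda_{\rm qo},\Lambda_{\rm sep}>0$ be constants such that properties (i)–(iv) of the context hold for all $\mathcal T\in\mathbb T(\delta_2)$. Then there exists a constant $\Lambda_{\rm stab}$, which exclusively depends on $\Lambda_{\rm sep},\Omega,\sigma,\delta_2$, and $\mathbb T$ (including the approximation constant of the family of discrete spaces over $\mathbb T$), such that for every $\mathcal T\in\mathbb T(\delta_2)$ with maximal mesh-size $h_{\max}\le\delta_2$ and every admissible refinement $\widehat{\mathcal T}\in\mathbb T$ of $\mathcal T$, the discrete eigenvectors $u_h\in V(\mathcal T)$ and $\widehat u_h\in V(\widehat{\mathcal T})$ of number $j$ satisfy $$\|\widehat u_h-u_h\|_{L^2(\Omega)}\le\Lambda_{\rm stab}\,h_{\max}^{\sigma}\,|||\widehat u_h-u_h|||.$$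
   Context: Continuous problem. $\Omega\subset\mathbb R^2$ is a bounded Lipschitz domain with polygonal boundary, $V:=H^2_0(\Omega)$, $a(u,v):=\int_\Omega D^2u:D^2v\,dx$ with norm $|||v|||:=a(v,v)^{1/2}$ on $V$, and $b(u,v):=\int_\Omega uv\,dx$ with norm $\|v\|:=\|v\|_{L^2(\Omega)}$. The eigenvalues $0<\lambda_1\le\lambda_2\le\dots\to\infty$ of $a(u,v)=\lambda b(u,v)$ for all $v\in V$ are enumerated with multiplicity, $\lambda_0:=0$. $j\in\mathbb N$ is fixed, $\lambda=\lambda_j$ is simple, and $u\in V$ with $\|u\|=1$ is a fixed corresponding eigenvector. Regularity. $\sigma:=\min\{1,\sigma_{\rm reg}\}$, where $\sigma_{\rm reg}>1/2$ is the elliptic regularity index of $\Omega$: there is a constant $C_{\rm reg}$ depending only on $\Omega$ such that for every $g\in L^2(\Omega)$ the solution $z\in V$ of $a(z,\bullet)=b(g,\bullet)$ belongs to $H^{2+\sigma}(\Omega)$ with $\|z\|_{H^{2+\sigma}(\Omega)}\le C_{\rm reg}\|g\|$. Triangulations and discrete spaces. $\mathbb T$ is the set of all regular triangulations of $\Omega$ obtained by newest-vertex bisection from a fixed initial triangulation (hence uniformly shape-regular); $\mathbb T(\delta)$ is the subset of those with maximal triangle diameter $h_{\max}\le\delta$. Each $\mathcal T\in\mathbb T$ comes with a finite-dimensional space $V(\mathcal T)\subset V$; the spaces are nested, $V(\mathcal T)\subset V(\widehat{\mathcal T})$ for every refinement $\widehat{\mathcal T}\in\mathbb T$ of $\mathcal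 T\in\mathbb T$, and have the standard approximation property $\min_{v_h\in V(\mathcal T)}|||z-v_h|||\le C_{\rm apx}h_{\max}^{\sigma}\|z\|_{H^{2+\sigma}(\Omega)}$ for all $z\in V\cap H^{2+\sigma}(\Omega)$ and $\mathcal T\in\mathbb T$, with $C_{\rm apx}$ depending only on $\mathbb T,\Omega,\sigma$. (The hierarchical Argyris spaces are the example of interest.) Discrete problem. With $N=\dim V(\mathcal T)$, let $0<\lambda_h^{(1)}\le\dots\le\lambda_h^{(N)}$ be the discrete eigenvalues, counted with multiplicity, of $a(u_h,v_h)=\lambda_hb(u_h,v_h)$ for all $v_h\in V(\mathcal T)$, with $u_h\in V(\mathcal T)$, $\|u_h\|=1$; $\lambda_h^{(0)}:=0$ and $\lambda_h^{(k)}:=\infty$ for $k>N$. Write $(\lambda_h,u_h)$ for the discrete eigenpair number $j$ on $\mathcal T$, with sign of $u_h$ chosen such that $b(u,u_h)\ge0$; $(\widehat\lambda_h,\widehat u_h)$ denotes the same for $\widehat{\mathcal T}$. Properties for $\mathcal T\in\mathbb T(\delta_2)$: (i) $\dim V(\mathcal T)\ge j$ and ${\rm LB}:=|||u-u_h|||^2+\lambda_h-\lambda+\|u-u_h\|^2\le\Lambda_{\rm qo}\min_{v_h\in V(\mathcal T)}|||u-v_h|||^2$; (ii) ${\rm LB}<1/2$; (iii) $\lambda_{j-1}\le\lambda_h^{(j-1)}<\lambda_j\le\lambda_h^{(j)}<\lambda_{j+1}\le\lambda_h^{(j+1)}$; (iv) $\max\Bigl\{\dfrac{\lambda_j}{\lambda_j-\lambda_h^{(j-1)}},\dfrac{\lambda_h^{(j)}}{\lambda_h^{(j+1)}-\lambda_h^{(j)}}\Bigr\}\le\Lambda_{\rm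 sep}$. *)

(* Defs.v *)
From HB Require Import structures.
From mathcomp Require Import all_boot all_order all_algebra.
From mathcomp Require Import all_classical all_reals all_analysis.
Set Implicit Arguments.
Unset Strict Implicit.
Unset Printing Implicit Defensive.
Import Order.TTheory GRing.Theory Num.Theory.
Import numFieldNormedType.Exports.

Local Open Scope classical_set_scope.
Local Open Scope ring_scope.

Notation plane R := (R * R)%type.

Section Plane.
Variable R : realType.
Implicit Types (x y p q : plane R) (A : set (plane R)).

Definition mu2 : set (measurableTypeR R * measurableTypeR R) -> \bar R :=
  (@lebesgue_measure R \x @lebesgue_measure R)%E.

(* The library norm of [R * R] is the maximum norm. *)
Definition eucl_dist x y : R :=
  Num.sqrt ((x.1 - y.1) ^+ 2 + (x.2 - y.2) ^+ 2).

Definition diam A : R := sup [set d | exists x y, [/\ A x, A y & d = eucl_dist x y]].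

Definition segm p q : set (plane R) :=
  [set x | exists2 t : R, 0 <= t <= 1 & x = (1 - t) *: p + t *: q].

Definition bdry A : set (plane R) := closure A `\` interior A.

(* Near each boundary point x0 there are orthonormal coordinates (xi, eta),
   with origin x0 and axes (c, s), (- s, c), and a Lipschitz function g such
   that in a rectangle around x0 the set A is the part strictly above the
   graph of g.  The Lipschitz constants are uniform for bounded A, the
   boundary being compact. *)
Definition lipschitz_boundary A := forall x0, bdry A x0 ->
  exists (c s r h L : R) (g : R -> R),
    [/\ c ^+ 2 + s ^+ 2 = 1, 0 < r, 0 < h,
        (forall t t', `|g t - g t'| <= L * `|t - t'|) &
        forall x, let xi := c * (x.1 - x0.1) + s * (x.2 - x0.2) in
          let eta := - s * (x.1 - x0.1) + c * (x.2 - x0.2) in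
          `|xi| < r -> `|eta| < h -> (A x <-> g xi < eta)].

Definition polygonal_boundary A := exists e : seq (plane R * plane R),
  bdry A = \bigcup_(pq in [set` e]) segm pq.1 pq.2.

Definition polygonal_lipschitz_domain A :=
  [/\ open A, connected A, A !=set0, bounded_set A
    & lipschitz_boundary A /\ polygonal_boundary A].

End Plane.

Section Sobolev.
Variables (R : realType) (Omega : set (plane R)).
Implicit Types (f g phi : plane R -> R) (i k l : 'I_2).

Definition basis_vec i : plane R := if i == ord0 then (1, 0) else (0, 1).

Definition partial i phi : plane R -> R := fun x => 'D_(basis_vec i) phi x.

Definition smooth phi := forall (s : seq 'I_2) x,
  differentiable (foldr partial phi s) x.

Definition test_function phi :=
  let supp := closure [set x | phi x != 0] in
  [/\ smooth phi, compact supp & supp `<=` Omega].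

Definition L2 f :=
  @measurable_fun _ _ (measurableTypeR R * measurableTypeR R)%type R Omega f /\
  (\int[@mu2 R]_(x in Omega) ((f x) ^+ 2)%:E < +oo)%E.

Definition l2dot f g : R := \int[@mu2 R]_(x in Omega) (f x * g x).

Definition l2norm f : R := Num.sqrt (l2dot f f).

(* [d] is the weak derivative of [f] in direction [i]; used for [f] and [d]
   in L2, where both integrals converge. *)
Definition weak_partial i f d := forall phi, test_function phi ->
  l2dot f (partial i phi) = - l2dot d phi.

(* Elements of H^2 are represented by a function together with
   representatives of its weak derivatives: [(f, grad, hess)] with [grad i]
   the derivative of [f] in direction [i] and [hess i k] that of [grad i] in
   direction [k].  The weak derivatives are determined a.e. by [f]. *)
Definition jet : Type :=
  ((plane R -> R) * ('I_2 -> plane R -> R) * ('I_2 -> 'I_2 -> plane R -> R))%type.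

Definition jval (u : jet) := u.1.1.
Definition jgrad (u : jet) := u.1.2.
Definition jhess (u : jet) := u.2.

Implicit Types u v w z : jet.

Definition H2 w :=
  [/\ L2 (jval w), forall i, L2 (jgrad w i), forall i k, L2 (jhess w i k),
      forall i, weak_partial i (jval w) (jgrad w i)
    & forall i k, weak_partial k (jgrad w i) (jhess w i k)].

Definition H2norm w : R := Num.sqrt (l2norm (jval w) ^+ 2
  + \sum_i l2norm (jgrad w i) ^+ 2
  + \sum_i \sum_k l2norm (jhess w i k) ^+ 2).

Definition jet_of phi : jet :=
  (phi, fun i => partial i phi, fun i k => partial k (partial i phi)).

Definition H20 : set jet := [set w | H2 w /\ forall e : R, 0 < e ->
  exists2 phi, test_function phi & H2norm (w - jet_of phi) < e].

Definition forma u v : R :=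
  \int[@mu2 R]_(x in Omega) \sum_i \sum_k jhess u i k x * jhess v i k x.
Definition enorm u : R := Num.sqrt (forma u u).

Definition formb u v : R := l2dot (jval u) (jval v).
Definition bnorm u : R := l2norm (jval u).

(* Sobolev-Slobodeckij spaces H^(2+s) for 0 < s <= 1: integer order for
   s = 1, Gagliardo seminorms of the second derivatives for s < 1. *)
Definition gagliardo (s : R) f : \bar R :=
  (\int[@mu2 R]_(x in Omega) \int[@mu2 R]_(y in Omega)
     ((f x - f y) ^+ 2 / eucl_dist x y `^ (2 + 2 * s))%:E)%E.

Definition weakD l f : plane R -> R :=
  xget (fun=> 0) [set d | L2 d /\ weak_partial l f d].

Definition H2s (s : R) : set jet := [set z | H2 z /\
  if s == 1 then forall i k l, exists d, L2 d /\ weak_partial l (jhess z i k) d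
  else forall i k, (gagliardo s (jhess z i k) < +oo)%E].

Definition H2s_norm (s : R) z : R := Num.sqrt (H2norm z ^+ 2 +
  if s == 1 then \sum_i \sum_k \sum_l l2norm (weakD l (jhess z i k)) ^+ 2
  else \sum_i \sum_k fine (gagliardo s (jhess z i k))).

Definition elliptic_regularity (s : R) := exists Creg : R,
  forall g, L2 g -> exists z, [/\ H20 z,
    forall v, H20 v -> forma z v = l2dot g (jval v),
    H2s s z & H2s_norm s z <= Creg * l2norm g].

(* Linear algebra in spaces of jets; vectors are identified when their values
   agree a.e. in Omega. *)
Definition aeeq u v :=
  {ae @mu2 R, forall x, Omega x -> jval u x = jval v x}.

Definition linear_subspace (W : set jet) :=
  [/\ W `<=` H20, W 0 & forall (c : R) u v, W u -> W v -> W (c *: u + v)].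

Definition has_dim (W : set jet) (n : nat) := exists e : 'I_n -> jet,
  [/\ forall m : 'I_n, W (e m),
      forall c : 'I_n -> R, aeeq (\sum_m c m *: e m) 0 -> forall m, c m = 0
    & forall w, W w -> exists c : 'I_n -> R, aeeq w (\sum_m c m *: e m)].

Definition eigspace (W : set jet) (m : R) : set jet :=
  [set w | W w /\ forall v, W v -> forma w v = m * formb w v].

(* [l k], [k] in [I], are the eigenvalues on [W] in nondecreasing order and
   counted with multiplicity. *)
Definition spectrum (W : set jet) (I : set nat) (l : nat -> R) :=
  [/\ forall k : nat, I k -> 0 < l k,
      forall k m : nat, I k -> I m -> (k <= m)%N -> l k <= l m
    & forall m : R, exists2 n, has_dim (eigspace W m) n &
        ([set k : nat | I k /\ l k = m] #= `I_n)%card].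

End Sobolev.

Section Triangulations.
Variable R : realType.

(* The refinement edge is the one opposite to the newest vertex. *)
Record triangle := Triangle
  { newest : plane R; vert1 : plane R; vert2 : plane R }.
Implicit Types (t : triangle) (T : set triangle).

Definition verts t : set (plane R) := [set newest t; vert1 t; vert2 t].

Definition hull t : set (plane R) := [set x | exists a b c : R,
  [/\ 0 <= a, 0 <= b, 0 <= c, a + b + c = 1
    & x = a *: newest t + b *: vert1 t + c *: vert2 t]].

Definition nondegenerate_triangle t :=
  let p := vert1 t - newest t in let q := vert2 t - newest t in
  p.1 * q.2 - p.2 * q.1 != 0.

Definition regular_triangulation (Omega : set (plane R)) T :=
  [/\ finite_set T, forall t, T t -> nondegenerate_triangle t,
      \bigcup_(t in T) hull t = closure Omega
    & forall t t', T t -> T t' -> t <> t' ->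
      let I := hull t `&` hull t' in let V := verts t `&` verts t' in
      [\/ I = set0, exists2 p, V p & I = [set p]
        | exists p q, [/\ V p, V q, p <> q & I = segm p q]]].

Definition midpoint (p q : plane R) : plane R := 2^-1 *: (p + q).

Definition children t : set triangle :=
  let m := midpoint (vert1 t) (vert2 t) in
  [set Triangle m (newest t) (vert1 t); Triangle m (newest t) (vert2 t)].

(* [T'] arises from [T] by finitely many newest-vertex bisections; the
   intermediate partitions may have hanging nodes. *)
Inductive refines T : set triangle -> Prop :=
| refines_refl : refines T T
| refines_bisect T' t : refines T T' -> T' t ->
    refines T ((T' `\ t) `|` children t).

Definition hmax T : R := sup [set diam (hull t) | t in T].

Definition triangulations (Omega : set (plane R)) (T0 : set triangle) :
    set (set triangle) :=
  [set T | refines T0 T /\ regular_triangulation Omega T].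

Definition triangulations_upto Omega T0 (delta : R) : set (set triangle) :=
  [set T | triangulations Omega T0 T /\ hmax T <= delta].

End Triangulations.

Section Discrete.
Variables (R : realType) (Omega : set (plane R)).

(* [inf] is over values at elements of [W]; it is a minimum when [W] has
   finite dimension. *)
Definition best_approx (W : set (jet R)) (z : jet R) : R :=
  inf [set enorm Omega (z - w) | w in W].

Definition discrete_spaces (T0 : set (triangle R)) (s Capx : R)
    (V : set (triangle R) -> set (jet R)) (N : set (triangle R) -> nat) :=
  [/\ forall T, triangulations Omega T0 T ->
        linear_subspace Omega (V T) /\ has_dim Omega (V T) (N T),
      forall T T', triangulations Omega T0 T -> triangulations Omega T0 T' ->
        refines T T' -> V T `<=` V T'
    & forall T z, triangulations Omega T0 T -> H20 Omega z -> H2s Omega s z ->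
        best_approx (V T) z <= Capx * hmax T `^ s * H2s_norm Omega s z].

(* The conventions lambda_h^(0) = 0 and lambda_h^(k) = oo for k > N. *)
Definition ext_eigenvalue (N : nat) (l : nat -> R) (k : nat) : \bar R :=
  if k == 0%N then 0%E else if (k <= N)%N then (l k)%:E else +oo%E.

Definition unit_eigenvector (W : set (jet R)) (m : R) (w : jet R) :=
  eigspace Omega W m w /\ bnorm Omega w = 1.

Definition LB (lam lamh : R) (u uh : jet R) : R :=
  enorm Omega (u - uh) ^+ 2 + lamh - lam + bnorm Omega (u - uh) ^+ 2.

(* The quotients in [separation] are extended real; one with infinite
   denominator is 0. *)
Definition separation (lam : nat -> R) (lamh : nat -> \bar R) (j : nat) : \bar R :=
  (maxe ((lam j)%:E / ((lam j)%:E - lamh j.-1))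
        (lamh j / (lamh j.+1 - lamh j)))%E.

End Discrete.

(* Main.v *)
(** Let [g] be the [a]-orthogonal projection of the fine eigenvector [u'] onto
    the coarse space.  In a [b]-orthonormal basis [f_i] of coarse eigenvectors
    the eigenvalue equations give
    [(l_i - l') b(g, f_i) = l' b(u' - g, f_i)], so by the spectral gap the
    components of [g] off the [j]-th coarse eigenvector are bounded by [Lsep]
    times those of [u' - g], and [||u' - uh||] is controlled by [||u' - g||].
    The gap enters through [lam_j <= l' <= l_j], the upper bound being
    Courant-Fischer on the nested spaces.  An Aubin-Nitsche duality argument
    with the elliptic regularity bounds [||u' - g||] by [h^sigma |||u' - g|||],
    and [|||u' - g||| <= |||u' - uh|||] by best approximation.

    Vectors are only determined up to values a.e., so one needs that an element
    of [H20] with vanishing values has vanishing energy; this follows from the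
    density of test functions. *)

Require Import Defs.
From HB Require Import structures.
From mathcomp Require Import all_boot all_order all_algebra.
From mathcomp Require Import all_classical all_reals all_analysis.
From mathcomp Require Import measurable_realfun ring lra zify.
Set Implicit Arguments.
Unset Strict Implicit.
Unset Printing Implicit Defensive.
Import Order.TTheory GRing.Theory Num.Theory.
Import numFieldNormedType.Exports.
Local Open Scope classical_set_scope.
Local Open Scope ring_scope.

(** * Symmetric positive semidefinite forms and their eigenbases *)

Section Forms.
Variables (R : realType) (E : lmodType R).
Implicit Types (W H : set E) (a b : E -> E -> R) (u v w : E).

Definition lin_closed W := W 0 /\ forall (c : R) u v, W u -> W v -> W (c *: u + v).

(** The laws are relative to a set [H], since integrals are bilinear only on square integrable
    arguments. A kernel is allowed, as jets are not quotiented by a.e. equality. *)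
Definition psd_form H a :=
  [/\ forall u v, H u -> H v -> a u v = a v u,
      forall c u v w, H u -> H v -> H w -> a (c *: u + v) w = c * a u w + a v w
    & forall u, H u -> 0 <= a u u].

Section Closure.
Variables (W : set E) (hW : lin_closed W).

Lemma lin_closed0 : W 0. Proof. by case: hW. Qed.

Lemma lin_closedD u v : W u -> W v -> W (u + v).
Proof. by move=> hu hv; rewrite -[u]scale1r; apply: hW.2. Qed.

Lemma lin_closedZ c u : W u -> W (c *: u).
Proof. by move=> hu; rewrite -[c *: u]addr0; apply: hW.2 => //; exact: lin_closed0. Qed.

Lemma lin_closedB u v : W u -> W v -> W (u - v).
Proof. by move=> hu hv; rewrite -scaleN1r; apply: lin_closedD => //; exact: lin_closedZ. Qed.

Lemma lin_closed_sum (I : finType) (P : pred I) (F : I -> E) :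
  (forall i, P i -> W (F i)) -> W (\sum_(i | P i) F i).
Proof. by move=> hF; apply: big_ind => //; [exact: lin_closed0 | exact: lin_closedD]. Qed.

Lemma lin_closed_comb (I : finType) (P : pred I) (c : I -> R) (F : I -> E) :
  (forall i, W (F i)) -> W (\sum_(i | P i) c i *: F i).
Proof. by move=> hF; apply: lin_closed_sum => i _; exact: lin_closedZ. Qed.

End Closure.

(** * One semidefinite form: Cauchy-Schwarz and orthonormal families *)

Section OneForm.
Variables (H : set E) (a : E -> E -> R).
Hypotheses (hH : lin_closed H) (ha : psd_form H a).

Let H0 := lin_closed0 hH.

Lemma psdC u v : H u -> H v -> a u v = a v u.
Proof. by case: ha => h _ _; exact: h. Qed.

Lemma psd_ge0 u : H u -> 0 <= a u u.
Proof. by case: ha => _ _; exact. Qed.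

Lemma psd0l w : H w -> a 0 w = 0.
Proof.
case: ha => _ h _ hw; have := h 1 0 0 w H0 H0 hw.
rewrite scaler0 addr0 mul1r => /eqP; rewrite -subr_eq0 opprD addrA subrr sub0r.
by rewrite oppr_eq0 => /eqP.
Qed.

Lemma psdZl c u w : H u -> H w -> a (c *: u) w = c * a u w.
Proof.
by case: (ha) => _ h _ hu hw; rewrite -[c *: u]addr0 h// psd0l// addr0.
Qed.

Lemma psdDl u v w : H u -> H v -> H w -> a (u + v) w = a u w + a v w.
Proof. by case: ha => _ h _ hu hv hw; rewrite -[u in LHS]scale1r h// mul1r. Qed.

Lemma psdBl u v w : H u -> H v -> H w -> a (u - v) w = a u w - a v w.
Proof.
move=> hu hv hw; rewrite -scaleN1r psdDl//; last exact: lin_closedZ.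
by rewrite psdZl// mulN1r.
Qed.

Lemma psdZr c u w : H u -> H w -> a w (c *: u) = c * a w u.
Proof.
by move=> hu hw; rewrite psdC// ?psdZl// 1?psdC//; exact: lin_closedZ.
Qed.

Lemma psdDr u v w : H u -> H v -> H w -> a w (u + v) = a w u + a w v.
Proof.
move=> hu hv hw; rewrite psdC//; last exact: lin_closedD.
by rewrite psdDl// !(psdC hw).
Qed.

Lemma psdBr u v w : H u -> H v -> H w -> a w (u - v) = a w u - a w v.
Proof.
move=> hu hv hw; rewrite psdC//; last exact: lin_closedB.
by rewrite psdBl// !(psdC hw).
Qed.

Lemma psd_suml (I : finType) (P : pred I) (c : I -> R) (F : I -> E) w :
  (forall i, H (F i)) -> H w ->
  a (\sum_(i | P i) c i *: F i) w = \sum_(i | P i) c i * a (F i) w.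
Proof.
move=> hF hw.
suff [] : H (\sum_(i | P i) c i *: F i) /\
  a (\sum_(i | P i) c i *: F i) w = \sum_(i | P i) c i * a (F i) w by [].
apply: (big_rec2 (fun x y => H x /\ a x w = y)).
  by split => //; exact: psd0l.
move=> i y x _ [hx <-]; split; first by apply: hH.2.
by rewrite psdDl ?psdZl//; exact: lin_closedZ.
Qed.

Lemma psd_sumr (I : finType) (P : pred I) (c : I -> R) (F : I -> E) w :
  (forall i, H (F i)) -> H w ->
  a w (\sum_(i | P i) c i *: F i) = \sum_(i | P i) c i * a w (F i).
Proof.
move=> hF hw; rewrite psdC//; last exact: lin_closed_comb.
by rewrite psd_suml//; apply: eq_bigr => i _; rewrite (psdC hw).
Qed.

Lemma psd_sqD u v : H u -> H v ->
  a (u + v) (u + v) = a u u + 2 * a u v + a v v.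
Proof.
move=> hu hv; have huv := lin_closedD hH hu hv.
by rewrite psdDl// !psdDr// (psdC hv hu); ring.
Qed.

Lemma psd_sqB u v : H u -> H v ->
  a (u - v) (u - v) = a u u - 2 * a u v + a v v.
Proof.
move=> hu hv; have huv := lin_closedB hH hu hv.
by rewrite psdBl// !psdBr// (psdC hv hu); ring.
Qed.

Lemma psd_CS u v : H u -> H v -> a u v ^+ 2 <= a u u * a v v.
Proof.
move=> hu hv.
have P (t : R) : 0 <= t ^+ 2 * a u u - 2 * t * a u v + a v v.
  have := psd_ge0 (lin_closedB hH (lin_closedZ hH t hu) hv).
  rewrite psd_sqB//; last exact: lin_closedZ.
  by rewrite psdZl ?psdZr ?psdZl//; [lra | exact: lin_closedZ].
have := psd_ge0 hu; rewrite le_eqVlt => /predU1P[a0|a_gt0].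
  have [->|a1] := eqVneq (a u v) 0.
    by rewrite expr0n/= mulr_ge0// psd_ge0.
  (* With [a u u = 0] the quadratic in [P] is affine in [t]; this [t] would give it the value -1. *)
  have := P ((a v v + 1) / (2 * a u v)); rewrite -a0 mulr0 add0r.
  have -> : 2 * ((a v v + 1) / (2 * a u v)) * a u v = a v v + 1 by field.
  lra.
have := P (a u v / a u u).
have -> : (a u v / a u u) ^+ 2 * a u u - 2 * (a u v / a u u) * a u v + a v v =
  (a u u * a v v - a u v ^+ 2) / a u u by field; rewrite gt_eqF.
by rewrite pmulr_lge0 ?invr_gt0// subr_ge0.
Qed.

Lemma psd_null u v : H u -> H v -> a u u = 0 -> a u v = 0.
Proof.
move=> hu hv u0; apply/eqP; rewrite -sqrf_eq0 eq_le sqr_ge0 andbT.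
by have := psd_CS hu hv; rewrite u0 mul0r.
Qed.

Lemma psd_CS_sqrt u v : H u -> H v ->
  `|a u v| <= Num.sqrt (a u u) * Num.sqrt (a v v).
Proof.
move=> hu hv; rewrite -sqrtrM ?psd_ge0// -sqrtr_sqr.
by rewrite ler_wsqrtr// psd_CS.
Qed.

Lemma psd_triangle u v : H u -> H v ->
  Num.sqrt (a (u + v) (u + v)) <= Num.sqrt (a u u) + Num.sqrt (a v v).
Proof.
move=> hu hv; rewrite -ler_sqr ?nnegrE ?sqrtr_ge0 ?addr_ge0 ?sqrtr_ge0//.
rewrite sqr_sqrtr; last by apply: psd_ge0; exact: lin_closedD.
rewrite sqrrD !sqr_sqrtr ?psd_ge0// psd_sqD//.
have := le_trans (ler_norm _) (psd_CS_sqrt hu hv).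
rewrite -mulr_natl; lra.
Qed.

(** Settles the relative sign of two unit vectors near a common [w]: by the parallelogram law their
    squared distance, which is 2 - 2 [a u v], stays below 2. *)
Lemma psd_close_ge0 w u v : H w -> H u -> H v -> a u u = 1 -> a v v = 1 ->
  a (w - u) (w - u) < 2^-1 -> a (w - v) (w - v) < 2^-1 -> 0 <= a u v.
Proof.
move=> hw hu hv u1 v1 wu wv.
have [hx hy] := (lin_closedB hH hw hu, lin_closedB hH hw hv).
have xy : (w - v) - (w - u) = u - v by rewrite opprB addrC addrA subrK.
have := psd_sqB hy hx; rewrite xy psd_sqB// u1 v1.
have := psd_sqD hy hx; have := psd_ge0 (lin_closedD hH hy hx); lra.
Qed.

(** Linear independence modulo the kernel of [a]. *)
Definition free_family n (e : 'I_n -> E) := forall c : 'I_n -> R,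
  a (\sum_i c i *: e i) (\sum_i c i *: e i) = 0 -> forall i, c i = 0.

Definition orthonormal n (e : 'I_n -> E) :=
  forall i k, a (e i) (e k) = (i == k)%:R.

Lemma orthonormal_coord n (f : 'I_n -> E) (P : pred 'I_n) (c : 'I_n -> R) k :
  (forall i, H (f i)) -> orthonormal f -> P k ->
  a (\sum_(i | P i) c i *: f i) (f k) = c k.
Proof.
move=> hf fo Pk; rewrite psd_suml// (bigD1 k)//= fo eqxx mulr1.
by rewrite big1 ?addr0// => i /andP[_ ik]; rewrite fo (negbTE ik) mulr0.
Qed.

Lemma orthonormal_sq n (f : 'I_n -> E) (P : pred 'I_n) (c : 'I_n -> R) :
  (forall i, H (f i)) -> orthonormal f ->
  a (\sum_(i | P i) c i *: f i) (\sum_(i | P i) c i *: f i) =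
  \sum_(i | P i) c i ^+ 2.
Proof.
move=> hf fo; rewrite psd_sumr//; last exact: lin_closed_comb.
by apply: eq_bigr => i Pi; rewrite orthonormal_coord// expr2.
Qed.

Lemma orthonormal_free n (f : 'I_n -> E) :
  (forall i, H (f i)) -> orthonormal f -> free_family f.
Proof.
move=> hf fo c; rewrite orthonormal_sq// => /psumr_eq0P s0 i.
by apply/eqP; rewrite -sqrf_eq0 s0// => k _; exact: sqr_ge0.
Qed.

Lemma bessel n (f : 'I_n -> E) (P : pred 'I_n) w : (forall i, H (f i)) ->
  orthonormal f -> H w -> \sum_(i | P i) a w (f i) ^+ 2 <= a w w.
Proof.
move=> hf fo hw; set s := \sum_(i | P i) a w (f i) *: f i.
have hs : H s by exact: lin_closed_comb.
have := psd_ge0 (lin_closedB hH hw hs).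
rewrite psd_sqB// orthonormal_sq// psd_sumr//.
under eq_bigr do rewrite -expr2; lra.
Qed.

(** Dimension count: the n x k matrix of products of [e] with [f] has a nonzero left kernel vector
    because k < n, and freeness of [e] makes the resulting combination normalisable. *)
Lemma exists_unit_orthogonal n k (e : 'I_n -> E) (f : 'I_k -> E) :
  (k < n)%N -> (forall i, H (e i)) -> (forall i, H (f i)) -> free_family e ->
  exists c : 'I_n -> R, let w := \sum_i c i *: e i in
    a w w = 1 /\ forall i, a w (f i) = 0.
Proof.
move=> kn he hf fe; pose M := \matrix_(i < n, m < k) a (e i) (f m).
have : kermx M != 0.
  rewrite -mxrank_eq0 mxrank_ker -lt0n subn_gt0.
  exact: leq_ltn_trans (rank_leq_col M) kn.
move=> /rowV0Pn[x /sub_kermxP xM x0].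
pose w := \sum_i x 0 i *: e i.
have hw : H w by exact: lin_closed_comb.
have wf i : a w (f i) = 0.
  rewrite psd_suml//; have := congr1 (fun A : 'M[R]_(1, k) => A 0 i) xM.
  rewrite [in LHS]mxE [RHS]mxE => h; rewrite -[RHS]h; apply: eq_bigr => m _; rewrite mxE//.
have w_gt0 : 0 < a w w.
  rewrite lt_def psd_ge0// andbT; apply: contra x0 => /eqP /fe xi0.
  by apply/eqP/rowP => i; rewrite xi0 mxE.
exists (fun i => (Num.sqrt (a w w))^-1 * x 0 i) => /=.
under eq_bigr do rewrite -scalerA.
rewrite -scaler_sumr -/w; split=> [|i]; last by rewrite psdZl// wf mulr0.
rewrite psdZl ?psdZr//; last exact: lin_closedZ.
by rewrite mulrA -expr2 exprVn sqr_sqrtr ?ltW// mulVf// gt_eqF.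
Qed.

(** While fewer than n orthonormal vectors are found, the dimension count supplies one more unit
    vector orthogonal to them. *)
Lemma exists_orthonormal W n (e : 'I_n -> E) : lin_closed W -> W `<=` H ->
  (forall i, W (e i)) -> free_family e ->
  exists f : 'I_n -> E, (forall i, W (f i)) /\ orthonormal f.
Proof.
move=> hW WH We fe.
(* Indexing by [nat] lets a family of length m grow to m + 1 without casts between ordinals. *)
suff [f [Wf fo]] : exists f : nat -> E, (forall i, W (f i)) /\
    forall i k, (i < n)%N -> (k < n)%N -> a (f i) (f k) = (i == k)%:R.
  by exists (fun i => f i); split => // i k; rewrite fo.
elim: {-2}n (leqnn n) => [|m IHm] mn.
  by exists (fun=> 0); split => // _; exact: lin_closed0.
have [f [Wf fo]] := IHm (ltnW mn).
have [c [w1 wf]] := @exists_unit_orthogonal n m e (fun i => f i) mn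
  (fun i => WH _ (We i)) (fun i => WH _ (Wf i)) fe.
set w := \sum_i _ in w1 wf.
have Ww : W w by exact: lin_closed_comb.
exists (fun i => if i == m then w else f i); split => [i|i k].
  by case: ifP.
rewrite !ltnS (leq_eqVlt i) (leq_eqVlt k).
case: (eqVneq i m) => [->|im]; case: (eqVneq k m) => [->|km]//=.
- by move=> _ km'; rewrite (wf (Ordinal km')).
- move=> im' _; rewrite psdC; [|exact: WH|exact: WH].
  by rewrite (wf (Ordinal im')) (negbTE im).
- by move=> im' km'; rewrite fo.
Qed.

Definition spans W n (e : 'I_n -> E) := forall w, W w -> exists c : 'I_n -> R,
  a (w - \sum_i c i *: e i) (w - \sum_i c i *: e i) = 0.

(** The n + 1 vectors [f i] and [r] have dependent coordinates in the n vectors [e]. Pairing that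
    relation with each [f i] and then with [r] kills all coefficients unless [a r r = 0]. *)
Lemma orthonormal_complete W n (e f : 'I_n -> E) : lin_closed W -> W `<=` H ->
  (forall i, W (e i)) -> spans W e -> (forall i, W (f i)) -> orthonormal f ->
  forall w, W w -> let r := w - \sum_i a w (f i) *: f i in a r r = 0.
Proof.
move=> hW WH We span_e Wf fo w Ww r.
have He i : H (e i) by exact: WH.
have Hf i : H (f i) by exact: WH.
have Hw : H w by exact: WH.
have Ws : W (\sum_i a w (f i) *: f i) by exact: lin_closed_comb.
have Wr : W r by exact: lin_closedB.
have rf i : a r (f i) = 0.
  rewrite psdBl//; last exact: WH.
  by rewrite orthonormal_coord// subrr.
have [//|r0] := eqVneq (a r r) 0.
have [c cP] := choice (fun i => span_e _ (Wf i)).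
have [d dP] := span_e _ Wr.
(* The rows are the [e]-coordinates of the [f i] and, last, of [r]; a left kernel vector is a
   dependency (y, t) between them. *)
pose M := col_mx (\matrix_(i < n, k < n) c i k) (\row_k d k).
have : kermx M != 0.
  rewrite -mxrank_eq0 mxrank_ker -lt0n subn_gt0.
  by apply: leq_ltn_trans (rank_leq_col M) _; rewrite addn1.
move=> /rowV0Pn[x /sub_kermxP xM x0].
pose y i := x 0 (lshift 1 i); pose t := x 0 (rshift n 0).
pose s := \sum_i y i *: f i + t *: r.
have Hs : H s by apply: WH; apply: lin_closedD => //; [exact: lin_closed_comb | exact: lin_closedZ].
(* The relation holds only modulo the kernel of [a], so it is used through its pairings. *)
have s0 v : H v -> a s v = 0.
  move=> Hv; rewrite psdDl ?psdZl ?psd_suml//; try by apply: WH.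
  - have K g k (Hg : H g) : a (g - \sum_i k i *: e i) (g - \sum_i k i *: e i) = 0 ->
      a g v = \sum_i k i * a (e i) v.
      have Hk : H (\sum_i k i *: e i) by exact: lin_closed_comb.
      move=> /(psd_null (lin_closedB hH Hg Hk) Hv); rewrite psdBl// psd_suml//.
      by move=> /eqP; rewrite subr_eq0 => /eqP.
    under eq_bigr do rewrite (K _ _ (Hf _) (cP _)) mulr_sumr.
    rewrite (K _ _ (WH _ Wr) dP) exchange_big/= mulr_sumr -big_split/= big1// => k _.
    have := congr1 (fun A : 'M[R]_(1, n) => A 0 k) xM.
    rewrite !mxE big_split_ord/= big_ord1 => h.
    transitivity ((\sum_i y i * c i k + t * d k) * a (e k) v).
      by rewrite mulrDl mulr_suml; congr (_ + _); [apply: eq_bigr => i _|]; rewrite mulrA.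
    rewrite (_ : _ + _ = 0) ?mul0r// -[RHS]h; congr (_ + _).
      by apply: eq_bigr => i _; rewrite col_mxEu mxE.
    by rewrite col_mxEd mxE.
  - by apply: WH; exact: lin_closed_comb.
  - by apply: WH; exact: lin_closedZ.
have y0 i : y i = 0.
  rewrite -(s0 _ (Hf i)) psdDl//; try by apply: WH; [apply: lin_closed_comb|apply: lin_closedZ].
  - rewrite psdZl// ?rf ?mulr0 ?addr0 ?orthonormal_coord//; exact: WH.
  - by apply: WH; exact: lin_closed_comb.
  - by apply: WH; exact: lin_closedZ.
have t0 : t = 0.
  have := s0 _ (WH _ Wr); rewrite /s big1 ?add0r; last by move=> i _; rewrite y0 scale0r.
  rewrite psdZl; [|exact: WH|exact: WH].
  by move=> /eqP; rewrite mulf_eq0 (negbTE r0) orbF => /eqP.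
case/negP: x0; apply/eqP/rowP => i; rewrite mxE.
case: (split_ordP i) => k ->; first exact: y0.
by rewrite ord1.
Qed.

End OneForm.

(** * Two forms: eigenbases, Ritz projection and duality *)

Section TwoForms.
Variables (H : set E) (a b : E -> E -> R).
Hypotheses (hH : lin_closed H) (ha : psd_form H a) (hb : psd_form H b).

Definition eigvec W (m : R) w := W w /\ forall v, W v -> a w v = m * b w v.

Definition eigenbasis W n (l : 'I_n -> R) (f : 'I_n -> E) :=
  [/\ forall i, eigvec W (l i) (f i), orthonormal b f
    & forall w, W w -> let r := w - \sum_i b w (f i) *: f i in b r r = 0].

(** Lets identities modulo the kernel of [b], that is a.e. identities of values, be used in the
    energy form. *)
Definition null_dominated W := forall w, W w -> b w w = 0 -> a w w = 0.

Section Eigenbasis.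
Variables (W : set E) (n : nat) (l : 'I_n -> R) (f : 'I_n -> E).
Hypotheses (hW : lin_closed W) (WH : W `<=` H) (W0 : null_dominated W).
Hypothesis (hf : eigenbasis W l f).

Let Wf i : W (f i). Proof. by case: hf => h _ _; have [] := h i. Qed.
Let Hf i : H (f i). Proof. exact: WH. Qed.
Let fo : orthonormal b f. Proof. by case: hf. Qed.

Lemma eigenbasis_formb w v : W w -> H v ->
  b w v = \sum_i b w (f i) * b (f i) v.
Proof.
move=> Ww Hv; case: hf => _ _ /(_ _ Ww) /= r0.
have Ws : W (\sum_i b w (f i) *: f i) by exact: lin_closed_comb.
have := psd_null hH hb (WH (lin_closedB hW Ww Ws)) Hv r0.
rewrite (psdBl hH hb) ?(psd_suml hH hb)//; [|exact: WH|exact: WH].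
by move=> /eqP; rewrite subr_eq0 => /eqP.
Qed.

(** The remainder of the expansion is [b]-null, hence [a]-null by [W0], and drops out by
    Cauchy-Schwarz. *)
Lemma eigenbasis_forma w v : W w -> H v ->
  a w v = \sum_i b w (f i) * a (f i) v.
Proof.
move=> Ww Hv; case: hf => _ _ /(_ _ Ww) /= r0.
have Ws : W (\sum_i b w (f i) *: f i) by exact: lin_closed_comb.
have Wr := lin_closedB hW Ww Ws.
have := psd_null hH ha (WH Wr) Hv (W0 Wr r0).
rewrite (psdBl hH ha) ?(psd_suml hH ha)//; [|exact: WH|exact: WH].
by move=> /eqP; rewrite subr_eq0 => /eqP.
Qed.

Lemma eigenbasis_sqb w : W w -> b w w = \sum_i b w (f i) ^+ 2.
Proof.
move=> Ww; have Hw := WH Ww; rewrite eigenbasis_formb//.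
by apply: eq_bigr => i _; rewrite (psdC hb (Hf i) Hw) expr2.
Qed.

Lemma eigenbasis_sqa w : W w -> a w w = \sum_i l i * b w (f i) ^+ 2.
Proof.
move=> Ww; have Hw := WH Ww; rewrite eigenbasis_forma//.
apply: eq_bigr => i _; case: hf => /(_ i)[_ ->]// _ _.
by rewrite (psdC hb (Hf i) Hw); ring.
Qed.

Lemma eigvec_orth m w i : eigvec W m w -> m != l i -> b w (f i) = 0.
Proof.
move=> [Ww aw] ml; have Hw := WH Ww.
have := aw _ (Wf i); rewrite (psdC ha)//.
case: hf => /(_ i)[_ ->]// _ _; rewrite (psdC hb (Hf i) Hw) => /eqP.
rewrite -subr_eq0 -mulrBl mulf_eq0 subr_eq0 eq_sym (negbTE ml) /=.
by move=> /eqP.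
Qed.

End Eigenbasis.

(* Courant-Fischer: some unit vector in the span of the first j+1 coarse
   eigenvectors is b-orthogonal to the first j fine ones. *)
Lemma eigenvalue_mono W W' n n' (l : 'I_n -> R) (l' : 'I_n' -> R) f f'
    (j : 'I_n) (j' : 'I_n') :
  lin_closed W -> lin_closed W' -> W `<=` W' -> W' `<=` H ->
  null_dominated W' -> eigenbasis W l f -> eigenbasis W' l' f' ->
  (forall i k : 'I_n, (i <= k)%N -> l i <= l k) ->
  (forall i k : 'I_n', (i <= k)%N -> l' i <= l' k) ->
  j = j' :> nat -> l' j' <= l j.
Proof.
move=> hW hW' WW' WH' W0' hf hf' lmono lmono' jj'.
have WH : W `<=` H by move=> w /WW' /WH'.
have W0 : null_dominated W by move=> w /WW'; exact: W0'.
have Wf i : W (f i) by case: hf => h _ _; have [] := h i.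
have Wf' i : W' (f' i) by case: hf' => h _ _; have [] := h i.
have fo : orthonormal b f by case: hf.
pose g (i : 'I_j.+1) := f (widen_ord (ltn_ord j) i).
pose g' (i : 'I_j) := f' (widen_ord (leq_trans (eq_leq jj') (ltnW (ltn_ord j'))) i).
have Hg i : H (g i) by apply: WH; exact: Wf.
have go : orthonormal b g by move=> i k; rewrite fo -val_eqE.
have Hg' i : H (g' i) by apply: WH'; exact: Wf'.
have [c [w1 wg']] := exists_unit_orthogonal hH hb (ltnSn j) Hg Hg' (orthonormal_free hH hb Hg go).
set w := \sum_i _ in w1 wg'.
have Ww : W w by apply: lin_closed_comb => // i; exact: Wf.
have W'w := WW' _ Ww.
have wf' (i : 'I_n') : (i < j)%N -> b w (f' i) = 0.
  move=> ij; rewrite -(wg' (Ordinal ij)) /g'; congr (b w (f' _)); exact: val_inj.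
have wf (i : 'I_n) : (j < i)%N -> b w (f i) = 0.
  move=> ji; rewrite (psd_suml hH hb)//; last exact: WH.
  rewrite big1// => k _; rewrite fo -val_eqE/= ltn_eqF ?mulr0//.
  exact: leq_ltn_trans (leq_ord k) ji.
(* The energy of the unit vector [w] is bounded from both sides: with no coarse components above [j]
   it is at most [l j], with no fine components below [j'] at least [l' j']. *)
have ub : a w w <= l j.
  rewrite (eigenbasis_sqa hW WH W0 hf)//.
  rewrite -[leRHS]mulr1 -w1 (eigenbasis_sqb hW WH hf)// mulr_sumr.
  apply: ler_sum => i _; have [ij|ij] := leqP i j.
    by rewrite ler_wpM2r ?sqr_ge0 ?lmono.
  by rewrite wf// expr0n !mulr0.
apply: le_trans ub; rewrite (eigenbasis_sqa hW' WH' W0' hf')//.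
rewrite -[leLHS]mulr1 -w1 (eigenbasis_sqb hW' WH' hf')// mulr_sumr.
apply: ler_sum => i _; have [ij|ij] := leqP j i.
  by rewrite ler_wpM2r ?sqr_ge0// lmono'// -jj'.
by rewrite wf'// expr0n !mulr0.
Qed.

(** Orthonormalise inside each eigenspace; distinct eigenvalues give orthogonality by symmetry, and
    n orthonormal vectors in a space spanned by n are complete. The injections [h] express that no
    value m is listed more often than its eigenspace has independent vectors. *)
Lemma exists_eigenbasis W n (e : 'I_n -> E) (l : 'I_n -> R) :
  lin_closed W -> W `<=` H -> (forall i, W (e i)) -> spans b W e ->
  (forall m, exists p, exists2 g : 'I_p -> E,
     (forall i, eigvec W m (g i)) /\ free_family b g &
     exists h : 'I_n -> nat, (forall i, l i = m -> (h i < p)%N) /\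
       forall i k, l i = m -> l k = m -> h i = h k -> i = k) ->
  exists f, eigenbasis W l f.
Proof.
move=> hW WH We span_e hl.
have He m : exists G : 'I_n -> E, (forall i, eigvec W m (G i)) /\
    forall i k, l i = m -> l k = m -> b (G i) (G k) = (i == k)%:R.
  have [p [g [gm gfree] [h [hp hinj]]]] := hl m.
  have hE : lin_closed (eigvec W m).
    split.
      split; first exact: lin_closed0.
      by move=> v Wv; have Hv := WH _ Wv; rewrite (psd0l hH ha)// (psd0l hH hb)// mulr0.
    move=> c u v [Wu au] [Wv av]; split; first exact: hW.2.
    move=> w Ww; have [[Hu Hv] Hw] := (WH _ Wu, WH _ Wv, WH _ Ww).
    have [[_ la _] [_ lb _]] := (ha, hb); rewrite la// lb// au// av//; ring.
  have [G [Gm Go]] := exists_orthonormal hH hb hE (fun w hw => WH w hw.1) gm gfree.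
  (* For indices of other eigenvalues [h i] may reach [p] or more; the default 0 still lies in the
     eigenspace. *)
  exists (fun i => if insub (h i) is Some q then G q else 0).
  split=> [i|i k im km].
    by case: insub => [q|]; [exact: Gm | exact: lin_closed0].
  rewrite !(insubT (fun q => q < p)%N (hp _ _))//.
  rewrite Go -val_eqE/=; congr (nat_of_bool _)%:R.
  by apply/eqP/eqP => [|->//]; exact: hinj.
have [G GP] := choice He.
pose f i := G (l i) i.
have fm i : eigvec W (l i) (f i) by have [h _] := GP (l i); exact: h.
have fo : orthonormal b f.
  move=> i k; have [ik|ik] := eqVneq (l i) (l k).
    by have [_ h] := GP (l i); rewrite /f -ik h.
  have [[Wi ai] [Wk ak]] := (fm i, fm k); have [Hi Hk] := (WH _ Wi, WH _ Wk).
  have := ai _ Wk; rewrite (psdC ha)// ak// (psdC hb Hk Hi) => /eqP.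
  rewrite -subr_eq0 -mulrBl mulf_eq0 subr_eq0 eq_sym (negbTE ik)/= => /eqP ->.
  by case: (eqVneq i k) ik => // ->; rewrite eqxx.
exists f; split => // w Ww.
by apply: (orthonormal_complete hH hb hW WH We span_e _ fo) => // i; have [] := fm i.
Qed.

(** Here [m] is the fine eigenvalue, [g] the [a]-projection of [u'] onto [W], and [s] bounds the
    inverse relative gap. *)
Lemma ritz_estimate W W' n (l : 'I_n -> R) f (j : 'I_n) (m s : R) u' uh :
  lin_closed W -> lin_closed W' -> W `<=` W' -> W' `<=` H ->
  null_dominated W' -> eigenbasis W l f ->
  (forall i, 0 < l i) -> (forall i, i != j -> l i != l j) -> 0 < m -> 0 <= s ->
  (forall i, i != j -> m <= s * `|l i - m|) ->
  eigvec W' m u' -> b u' u' = 1 -> eigvec W (l j) uh -> b uh uh = 1 ->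
  0 <= b u' uh ->
  exists g, [/\ W g, forall v, W v -> a (u' - g) v = 0 &
    Num.sqrt (b (u' - uh) (u' - uh)) <=
      2 * (1 + s) * Num.sqrt (b (u' - g) (u' - g))].
Proof.
move=> hW hW' WW' WH' W0' hf l_gt0 lj m_gt0 s_ge0 sep [Wu' au'] u'1 euh uh1 b_ge0.
have WH : W `<=` H by move=> w /WW' /WH'.
have W0 : null_dominated W by move=> w /WW'; exact: W0'.
have Wf i : W (f i) by case: hf => h _ _; have [] := h i.
have Hf i : H (f i) by exact: WH.
have fo : orthonormal b f by case: hf.
have Hu' : H u' by exact: WH'.
(* Coordinates of the projection, forced by [l i * b g (f i) = a g (f i) = a u' (f i) = m * b u' (f
   i)]. *)
pose p i := m / l i * b u' (f i).
pose g := \sum_i p i *: f i.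
have Wg : W g by exact: lin_closed_comb.
have Hg := WH _ Wg.
have He := lin_closedB hH Hu' Hg.
have Wuh : W uh by case: euh.
have Huh := WH _ Wuh.
exists g; split => //.
  move=> v Wv; have Hv := WH _ Wv.
  rewrite (psdBl hH ha)// (psdC ha Hu')// (psdC ha Hg)//.
  rewrite !(eigenbasis_forma hW WH W0 hf Wv)// -sumrB big1// => i _.
  have [/(_ i)[_ afi] _ _] := hf.
  rewrite (psdC ha (Hf i) Hu') au'; last exact: WW'.
  rewrite afi// (psdC hb (Hf i) Hg) /g (orthonormal_coord hH hb)// /p.
  by rewrite -mulrBr mulrA [l i * _]mulrC divfK ?gt_eqF// subrr mulr0.
set e := u' - g.
pose r := \sum_(i | i != j) p i *: f i.
have Hr : H r by exact: lin_closed_comb.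
have eps i : b e (f i) = b u' (f i) - p i.
  by rewrite (psdBl hH hb)// (orthonormal_coord hH hb).
(* From [m * b e (f i) = (l i - m) * p i] and the gap [m <= s * |l i - m|]. *)
have ple i : i != j -> p i ^+ 2 <= s ^+ 2 * b e (f i) ^+ 2.
  move=> ij; rewrite -exprMn -(real_normK (num_real (p i))).
  rewrite -(real_normK (num_real (s * b e (f i)))).
  rewrite ler_sqr ?nnegrE ?normr_ge0//.
  have E1 : m * b e (f i) = (l i - m) * p i.
    by rewrite eps /p; field; rewrite gt_eqF.
  rewrite -(ler_pM2l m_gt0).
  rewrite (normrM s) (ger0_norm s_ge0) mulrCA -[m in leRHS]gtr0_norm//.
  rewrite -(normrM m) E1 (normrM (l i - m)) mulrA.
  by rewrite ler_wpM2r ?normr_ge0 ?sep.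
have rle : Num.sqrt (b r r) <= s * Num.sqrt (b e e).
  rewrite -[s in leRHS]ger0_norm// -sqrtr_sqr -sqrtrM ?sqr_ge0// ler_wsqrtr//.
  rewrite (orthonormal_sq hH hb)//.
  apply: (le_trans (ler_sum _ ple)); rewrite -mulr_sumr ler_wpM2l ?sqr_ge0//.
  exact: (bessel hH hb).
(* Removing only the [j]-th component of [g] from [u'] leaves [e + r], of norm at most 1 + s times
   that of [e]. *)
have wE : u' - p j *: f j = e + r.
  by rewrite /e /g /r (bigD1 j)//= opprD addrA subrK.
have wle := psd_triangle hH hb He Hr.
have := le_trans wle (lerD (lexx _) rle) => {}wle.
(* Modulo the kernel, [uh] is plus or minus [f j], so the left side is the squared distance from
   [u'] to the line through [f j]. *)
have wge : 1 - b u' uh ^+ 2 <= b (e + r) (e + r).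
  have -> : b u' uh ^+ 2 = b u' (f j) ^+ 2.
    have C i : i != j -> b uh (f i) = 0.
      by move=> ij; apply: (eigvec_orth WH hf euh); rewrite eq_sym lj.
    have c1 : b uh (f j) ^+ 2 = 1.
      rewrite -uh1 (eigenbasis_sqb hW WH hf)// (bigD1 j)//= big1 ?addr0// => i ij.
      by rewrite C// expr0n.
    rewrite (psdC hb Hu')// (eigenbasis_formb hW WH hf)// (bigD1 j)//= big1 ?addr0 => [|i ij].
      by rewrite exprMn c1 mul1r (psdC hb (Hf j)).
    by rewrite C// mul0r.
  rewrite -wE (psd_sqB hH hb)//; last exact: lin_closedZ.
  rewrite !(psdZr hH hb)// ?(psdZl hH hb)//; last exact: lin_closedZ.
  rewrite fo eqxx u'1 mulr1.
  have := sqr_ge0 (b u' (f j) - p j); rewrite sqrrB expr2; lra.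
have Hd := lin_closedB hH Hu' Huh.
have bd : b (u' - uh) (u' - uh) = 2 - 2 * b u' uh.
  by rewrite (psd_sqB hH hb)// u'1 uh1; ring.
have b_le1 : b u' uh <= 1.
  by have := psd_ge0 hb Hd; rewrite bd; lra.
(* The sign condition enters here: t = [b u' uh] lies in [0, 1], so t^2 <= t and 2 - 2t <= 2(1 -
   t^2). *)
have ble : b (u' - uh) (u' - uh) <= 2 ^+ 2 * b (e + r) (e + r).
  by rewrite bd; nra.
apply: (@le_trans _ _ (2 * Num.sqrt (b (e + r) (e + r)))).
  by rewrite -[2]ger0_norm// -sqrtr_sqr -sqrtrM ?sqr_ge0// ler_wsqrtr.
rewrite -mulrA ler_wpM2l//; lra.
Qed.

(** [z] is tested as a dual solution with load [e]; orthogonality of [e] to [W] allows [v] to be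
    subtracted from [z] before Cauchy-Schwarz. *)
Lemma aubin_nitsche W e z v : W `<=` H -> H e -> H z -> W v ->
  (forall w, W w -> a e w = 0) -> a z e = b e e ->
  b e e <= Num.sqrt (a (z - v) (z - v)) * Num.sqrt (a e e).
Proof.
move=> WH He Hz Wv orth <-; have Hv := WH _ Wv.
have -> : a z e = a (z - v) e.
  by rewrite (psdBl hH ha)// (psdC ha Hv He) orth// subr0.
apply: (le_trans (ler_norm _)); apply: (psd_CS_sqrt hH ha) => //.
exact: lin_closedB.
Qed.

Lemma galerkin_best W w g v : lin_closed W -> W `<=` H -> H w -> W g -> W v ->
  (forall v, W v -> a (w - g) v = 0) ->
  a (w - g) (w - g) <= a (w - v) (w - v).
Proof.
move=> hW WH Hw Wg Wv orth; have [Hg Hv] := (WH _ Wg, WH _ Wv).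
have Wgv := lin_closedB hW Wg Wv; have Hgv := WH _ Wgv.
have -> : w - v = (w - g) + (g - v) by rewrite addrA subrK.
rewrite (psd_sqD hH ha (lin_closedB hH Hw Hg) Hgv).
by rewrite (orth _ Wgv) mulr0 addr0 lerDl (psd_ge0 ha).
Qed.

End TwoForms.

End Forms.

(** * Square integrable functions *)

Section SquareIntegrable.
Context d (T : measurableType d) (R : realType).
Variables (mu : {measure set T -> \bar R}) (D : set T).
Hypothesis mD : measurable D.
Implicit Types f g : T -> R.

Definition sq_integrable : set (T -> R) := [set f : T -> R | measurable_fun D f /\
  (\int[mu]_(x in D) ((f x) ^+ 2)%:E < +oo)%E].

Let integrable_sq f : sq_integrable f ->
  mu.-integrable D (EFin \o (fun x => f x ^+ 2)).
Proof.
move=> [mf fi]; apply/integrableP; split.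
  by apply/measurable_EFinP; exact: measurable_funX.
by under eq_integral => x _ do rewrite /= ger0_norm ?sqr_ge0//.
Qed.

Lemma sq_integrable_mul f g : sq_integrable f -> sq_integrable g ->
  mu.-integrable D (EFin \o (fun x => f x * g x)).
Proof.
move=> hf hg; have := integrableD mD (integrable_sq hf) (integrable_sq hg).
apply: le_integrable => //.
  by apply/measurable_EFinP; apply: measurable_funM; [case: hf|case: hg].
move=> x _ /=; rewrite lee_fin [leRHS]ger0_norm ?addr_ge0 ?sqr_ge0// ler_norml.
have := sqr_ge0 (f x - g x); rewrite sqrrB => ?.
have := sqr_ge0 (f x + g x); rewrite sqrrD => ?.
by have ? := sqr_ge0 (f x); have ? := sqr_ge0 (g x); apply/andP; split; lra.
Qed.

Lemma sq_integrable_lin : lin_closed sq_integrable.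
Proof.
split.
  split; first exact: measurable_cst.
  rewrite (eq_integral (cst 0%E)); last by move=> x _; rewrite /= expr0n.
  by rewrite integral0.
move=> c f g hf hg; have mfg : measurable_fun D (c *: f + g).
  apply: measurable_funD; last by case: hg.
  by apply: measurable_funM; [exact: measurable_cst|case: hf].
split=> //.
have i1 := integrableZl mD (c ^+ 2) (integrable_sq hf).
have i2 := integrableZl mD (2 * c) (sq_integrable_mul hf hg).
have /integrableP[_] := integrableD mD (integrableD mD i1 i2) (integrable_sq hg).
apply: le_lt_trans; apply: ge0_le_integral => //=.
- by move=> x _; rewrite lee_fin sqr_ge0.
- by apply/measurable_EFinP; exact: measurable_funX.
- apply: measurableT_comp => //.
  have /measurable_int := integrableD mD (integrableD mD i1 i2) (integrable_sq hg).
  by move=> h; apply: measurableT_comp => //; exact/measurable_EFinP.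
- move=> x _; rewrite lee_fin; apply: le_trans (ler_norm _).
  by rewrite (_ : (c *: f + g) x = c * f x + g x)// le_eqVlt; apply/orP/or_introl/eqP; ring.
Qed.

Lemma Rintegral_sum (I : Type) (s : seq I) (F : I -> T -> R) :
  (forall i, mu.-integrable D (EFin \o F i)) ->
  mu.-integrable D (EFin \o (fun x => \sum_(i <- s) F i x)) /\
  \int[mu]_(x in D) (\sum_(i <- s) F i x) = \sum_(i <- s) \int[mu]_(x in D) F i x.
Proof.
move=> hF; elim: s => [|i s [IHi IH]].
  split; last first.
    rewrite big_nil; under eq_Rintegral do rewrite big_nil.
    by rewrite Rintegral_cst// mul0r.
  by under eq_fun do rewrite /= big_nil; exact: integrable0.
have E : (fun x => \sum_(i <- i :: s) F i x) = (fun x => F i x + \sum_(i <- s) F i x).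
  by apply/funext => x; rewrite big_cons.
split; last by under eq_Rintegral do rewrite big_cons; rewrite RintegralD// IH big_cons.
by rewrite E; exact: (integrableD mD (hF i) IHi).
Qed.

Definition l2prod f g : R := \int[mu]_(x in D) (f x * g x).

Lemma l2prod_psd : psd_form sq_integrable l2prod.
Proof.
split=> [f g _ _|c f g h hf hg hh|f _].
- by apply: eq_Rintegral => x _; rewrite mulrC.
- rewrite /l2prod -RintegralZl//; last exact: sq_integrable_mul.
  rewrite -RintegralD//; last 2 first.
  - exact: (integrableZl mD c (sq_integrable_mul hf hh)).
  - exact: sq_integrable_mul.
  by apply: eq_Rintegral => x _; rewrite (_ : (c *: f + g) x = c * f x + g x)//; ring.
- by apply: Rintegral_ge0 => x _; rewrite -expr2 sqr_ge0.
Qed.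

Lemma l2prod_null f : sq_integrable f ->
  l2prod f f = 0 <-> {ae mu, forall x, D x -> f x = 0}.
Proof.
move=> hf; have [mf fi] := hf.
have m2 : measurable_fun D (EFin \o (fun x => f x ^+ 2)).
  by apply/measurable_EFinP; exact: measurable_funX.
have E : l2prod f f = 0 <-> (\int[mu]_(x in D) `|(f x ^+ 2)%:E| = 0)%E.
  rewrite /l2prod /Rintegral.
  have -> : (\int[mu]_(x in D) `|(f x ^+ 2)%:E| =
             \int[mu]_(x in D) (f x * f x)%:E)%E.
    by apply: eq_integral => x _; rewrite /= ger0_norm ?sqr_ge0.
  (* [fine] also sends infinite values to 0, so finiteness of the integral has to be supplied. *)
  split=> [|->//] /eqP; rewrite fine_eq0.
    by move=> /eqP.
  exact: (integrable_fin_num mD (sq_integrable_mul hf hf)).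
rewrite E ae_eq_integral_abs//; split; apply: filterS => x /= h Dx.
  by have /eqP := h Dx; rewrite eqe sqrf_eq0 => /eqP.
by rewrite h// expr0n.
Qed.

Lemma l2prod_subr_null f g : sq_integrable f -> sq_integrable g ->
  {ae mu, forall x, D x -> f x = g x} <-> l2prod (f - g) (f - g) = 0.
Proof.
move=> hf hg; rewrite l2prod_null; last exact: (lin_closedB sq_integrable_lin).
split; apply: filterS => x h Dx; apply/eqP.
  by rewrite subr_eq0; apply/eqP; exact: h.
by rewrite -subr_eq0; apply/eqP; exact: h.
Qed.

End SquareIntegrable.

(** * Lebesgue measure of the plane *)

Section PlaneMeasure.
Variable R : realType.
Notation mplane := (measurableTypeR R * measurableTypeR R)%type.

(** The sigma-algebra is the product one, so an open set is written as the countable union of the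
    rational squares it contains. *)
Lemma open_measurable_plane (U : set (plane R)) :
  open U -> measurable (U : set mplane).
Proof.
move=> oU.
pose B (p : rat * rat * nat) : set mplane :=
  (ball (ratr p.1.1 : R) p.2.+1%:R^-1) `*` (ball (ratr p.1.2 : R) p.2.+1%:R^-1).
have -> : (U : set mplane) = \bigcup_(p in [set p | B p `<=` U]) B p.
  apply/seteqP; split=> [[x y] Uxy|z [p BU Bz]]; last exact: BU.
  have /nbhs_ballP[e /= e0 eU] : nbhs (x, y) U by exact: open_nbhs_nbhs.
  (* Two points of a square of radius 1/(n+1) differ by less than 2/(n+1) < e in each coordinate. *)
  have [n /ltW ne] : exists n, n.+1%:R^-1 < e / 2.
    exists (Num.truncn (e / 2)^-1); rewrite invf_plt ?posrE ?divr_gt0 ?ltr0n//.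
    exact: truncnS_gt.
  have K (t d : R) : 0 < d -> exists q : rat, ball (ratr q : R) d t.
    move=> d0; have /rat_in_itvoo[q] : t - d < t + d by rewrite ltrD2l gtrN.
    rewrite in_itv/= => /andP[h1 h2].
    by exists q; rewrite -ball_normE/= ltr_norml; apply/andP; split; lra.
  have d0 : 0 < n.+1%:R^-1 :> R by rewrite invr_gt0 ltr0n.
  have [[q qx] [r ry]] := (K x _ d0, K y _ d0).
  exists (q, r, n) => // -[x' y'] [qx' ry']; apply: eU.
  have tri (t t' s : R) : ball (s : R) n.+1%:R^-1 t ->
      ball (s : R) n.+1%:R^-1 t' -> ball t e t'.
    move=> /ball_sym h1 h2; have := ball_triangle h1 h2; apply: le_ball.
    by rewrite [leRHS]splitr lerD.
  by split; [exact: tri qx qx' | exact: tri ry ry'].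
rewrite bigcup_mkcond; apply: countable_bigcupT_measurable => // p.
by case: ifP => _ //; apply: measurableX; exact: measurable_ball.
Qed.

Lemma continuous_measurable_plane (D : set (plane R)) (f : plane R -> R) :
  open D -> continuous f -> @measurable_fun _ _ mplane R D f.
Proof.
move=> oD /continuousP cf; apply: (measurability _ (RGenOpens.measurableE R)).
move=> _ [_ [a [b ->] <-]]; apply: open_measurable_plane.
by apply: openI => //; exact/cf/interval_open.
Qed.

HB.instance Definition _ := Measure.copy (@mu2 R)
  (@lebesgue_measure R \x @lebesgue_measure R)%E.

Lemma mu2_bounded_lty (D : set (plane R)) : open D -> bounded_set D ->
  (@mu2 R D < +oo)%E.
Proof.
move=> oD [M [_ bD]]; pose I : set (measurableTypeR R) := [set` `[- (M + 1), M + 1]].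
have mI : measurable I by exact: measurable_itv.
have DI : D `<=` I `*` I.
  have M1 : M < M + 1 by rewrite ltrDl.
  move=> [x y] /(bD _ M1); rewrite /= prod_normE ge_max => /andP[xM yM].
  by split; rewrite /I /= in_itv/= -ler_norml.
apply: (@le_lt_trans _ _ (@mu2 R (I `*` I))).
  apply: le_measure => //; rewrite inE; first exact: open_measurable_plane.
  exact: measurableX.
have [r Ir] : exists r, lebesgue_measure I = r%:E.
  rewrite (lebesgue_measure_itv `[- (M + 1), M + 1])/=.
  by case: ifP => _; rewrite -?EFinB; eexists.
have -> : @mu2 R (I `*` I) = (r * r)%:E by rewrite EFinM -Ir; exact: product_measure1E.
by rewrite ltry.
Qed.

End PlaneMeasure.

(** * The forms [a] and [b] on jets *)

Section SobolevForms.
Variables (R : realType) (Omega : set (plane R)).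
Hypotheses (oOmega : open Omega) (bOmega : bounded_set Omega).
Implicit Types (phi f g : plane R -> R) (u v w : jet R).

Let mOmega : measurable (Omega : set (measurableTypeR R * measurableTypeR R)).
Proof. exact: open_measurable_plane. Qed.

Lemma l2dot_psd : psd_form (L2 Omega) (l2dot Omega).
Proof. exact: (l2prod_psd (@mu2 R) mOmega). Qed.

Lemma L2_lin : lin_closed (L2 Omega).
Proof. exact: (sq_integrable_lin (@mu2 R) mOmega). Qed.

(** Ambient space [H] for the abstract results: square integrable values and second derivatives make
    both forms bilinear. *)
Definition jet2 : set (jet R) :=
  [set w | L2 Omega (jval w) /\ forall i k, L2 Omega (jhess w i k)].

Lemma jet2_lin : lin_closed jet2.
Proof.
split; first by split=> *; exact: (lin_closed0 L2_lin).
move=> c u v [u0 u2] [v0 v2]; split=> [|i k].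
  exact (L2_lin.2 c (jval u) (jval v) u0 v0).
exact (L2_lin.2 c (jhess u i k) (jhess v i k) (u2 i k) (v2 i k)).
Qed.

Lemma H20_jet2 : H20 Omega `<=` jet2.
Proof. by move=> w [[w0 _ w2 _ _] _]; split. Qed.

Lemma formb_psd : psd_form jet2 (formb Omega).
Proof.
have [hC hl h0] := l2dot_psd; split=> [u v [hu _] [hv _]|c u v w [hu _] [hv _] [hw _]|u [hu _]].
- exact (hC _ _ hu hv).
- exact (hl c (jval u) (jval v) (jval w) hu hv hw).
- exact (h0 _ hu).
Qed.

Lemma forma_sum u v : jet2 u -> jet2 v ->
  forma Omega u v = \sum_i \sum_k l2dot Omega (jhess u i k) (jhess v i k).
Proof.
move=> [_ hu] [_ hv]; rewrite /forma.
have I1 i k := sq_integrable_mul mOmega (hu i k) (hv i k).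
have I2 i := Rintegral_sum mOmega (index_enum 'I_2) (I1 i).
have [_ ->] := Rintegral_sum mOmega (index_enum 'I_2) (fun i => (I2 i).1).
by apply: eq_bigr => i _; rewrite (I2 i).2.
Qed.

Lemma forma_psd : psd_form jet2 (forma Omega).
Proof.
have [hC hl h0] := l2dot_psd; split=> [u v hu hv|c u v w hu hv hw|u hu].
- rewrite !forma_sum//; apply: eq_bigr => i _; apply: eq_bigr => k _.
  exact (hC _ _ (hu.2 i k) (hv.2 i k)).
- rewrite !forma_sum//; last exact: jet2_lin.2.
  rewrite mulr_sumr -big_split; apply: eq_bigr => i _.
  rewrite mulr_sumr -big_split; apply: eq_bigr => k _.
  exact (hl c (jhess u i k) (jhess v i k) (jhess w i k) (hu.2 i k) (hv.2 i k) (hw.2 i k)).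
- rewrite forma_sum//; apply: sumr_ge0 => i _; apply: sumr_ge0 => k _.
  exact (h0 _ (hu.2 i k)).
Qed.

(** Matches the a.e. identification of jets with the kernel of [b], which the abstract results work
    modulo. *)
Lemma aeeqP u v : jet2 u -> jet2 v ->
  aeeq Omega u v <-> formb Omega (u - v) (u - v) = 0.
Proof.
move=> [hu _] [hv _]; exact (l2prod_subr_null (mu := @mu2 R) mOmega hu hv).
Qed.

(** Off the closed support [phi] vanishes in a neighbourhood, so its derivative is that of a
    constant. *)
Lemma partial_supp i phi :
  [set x | partial i phi x != 0] `<=` closure [set x | phi x != 0].
Proof.
move=> x /= dx; apply: contrapT => /= cx; case/negP: dx; apply/eqP.
rewrite /partial -(derive_cst (0 : R) x (basis_vec R i)).
apply: near_eq_derive.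
have : nbhs x (~` closure [set x | phi x != 0]).
  apply: open_nbhs_nbhs; split => //; apply: closed_openC; exact: closed_closure.
apply: filterS => y cy; apply/eqP; apply: contrapT => /negP py; apply: cy.
exact: subset_closure.
Qed.

Lemma test_function_partial i phi :
  test_function Omega phi -> test_function Omega (partial i phi).
Proof.
move=> [sphi cphi phiO].
have S : closure [set x | partial i phi x != 0] `<=` closure [set x | phi x != 0].
  rewrite [X in _ `<=` X](closure_id _).1; last exact: closed_closure.
  by apply: closureS; exact: partial_supp.
split; last exact: subset_trans phiO.
- by move=> s x; have := sphi (rcons s i) x; rewrite foldr_rcons.
- by apply: subclosed_compact cphi S; exact: closed_closure.
Qed.

(** Continuity and compact support give boundedness, and [Omega] has finite measure. *)
Lemma test_function_L2 phi : test_function Omega phi -> L2 Omega phi.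
Proof.
move=> [sphi cphi _].
have cont : continuous phi by move=> x; apply: differentiable_continuous; exact: (sphi [::]).
have mphi : @measurable_fun _ _ (measurableTypeR R * measurableTypeR R)%type R Omega phi.
  exact: continuous_measurable_plane.
split=> //.
have [M [_ hM]] : bounded_set (phi @` closure [set x | phi x != 0]).
  apply: compact_bounded; apply: continuous_compact cphi.
  exact: continuous_subspaceT.
have M1 : M < `|M| + 1 by rewrite (le_lt_trans (ler_norm _))// ltrDl.
have phiM x : `|phi x| <= `|M| + 1.
  have [->|p0] := eqVneq (phi x) 0; first by rewrite normr0 addr_ge0.
  by apply: (hM _ M1); exists x => //; exact: subset_closure.
apply: (@le_lt_trans _ _ (\int[@mu2 R]_(x in Omega) ((`|M| + 1) ^+ 2)%:E)%E).
  apply: ge0_le_integral => //.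
  - by move=> x _; rewrite lee_fin sqr_ge0.
  - by apply/measurable_EFinP; exact: measurable_funX.
  - move=> x _; rewrite lee_fin -real_normK ?num_real// ler_sqr ?nnegrE ?addr_ge0//.
rewrite integral_cst// -ge0_fin_numE; last by rewrite mule_ge0// lee_fin sqr_ge0.
rewrite fin_numM// ge0_fin_numE//; exact: mu2_bounded_lty.
Qed.

Lemma l2norm_le_H2norm w i k : l2norm Omega (jhess w i k) <= H2norm Omega w.
Proof.
rewrite /H2norm -[leLHS]ger0_norm ?sqrtr_ge0// -sqrtr_sqr ler_wsqrtr//.
apply: ler_wpDl.
  by rewrite addr_ge0 ?sqr_ge0// sumr_ge0// => m _; rewrite sqr_ge0.
rewrite (bigD1 i)//= (bigD1 k)//= -addrA lerDl addr_ge0//.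
  by rewrite sumr_ge0// => m _; rewrite sqr_ge0.
by rewrite sumr_ge0// => m _; rewrite sumr_ge0// => p _; rewrite sqr_ge0.
Qed.

(* If [w] vanishes a.e. then its weak Hessian annihilates all test functions,
   hence also the limit of Hessians of test functions that it is. *)
Lemma H20_null w : H20 Omega w -> formb Omega w w = 0 -> forma Omega w w = 0.
Proof.
move=> hw; have [[w0 w1 w2 d1 d2] dens] := hw; move=> bw.
have hj := H20_jet2 hw.
(* Integration by parts twice moves both derivatives onto [phi], leaving a product with the null
   function [jval w]. *)
have orth i k phi : test_function Omega phi -> l2dot Omega (jhess w i k) phi = 0.
  move=> tphi; have tk := test_function_partial k tphi.
  have := d1 i _ tk; rewrite (d2 i k _ tphi) opprK => <-.
  apply: (psd_null L2_lin l2dot_psd) => //.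
  by apply: test_function_L2; exact: test_function_partial.
rewrite forma_sum//; apply: big1 => i _; apply: big1 => k _.
set h := jhess w i k; have hh : L2 Omega h by exact: w2.
apply/eqP; rewrite eq_le (psd_ge0 l2dot_psd)// andbT.
apply/ler_addgt0Pl => e e0; rewrite addr0.
(* This tolerance times the norm of [h] is at most [e]; the added 1 keeps the denominator
   positive. *)
have [phi tphi phie] := dens (e / (l2norm Omega h + 1))
  (divr_gt0 e0 (ltr_wpDl (sqrtr_ge0 _) ltr01)).
pose psi := partial k (partial i phi).
have tpsi : test_function Omega psi by do 2 apply: test_function_partial.
have hpsi := test_function_L2 tpsi.
have hd := lin_closedB L2_lin hh hpsi.
have -> : l2dot Omega h h = l2dot Omega h (h - psi).
  by rewrite (psdBr L2_lin l2dot_psd)// (orth i k psi tpsi) subr0.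
apply: (le_trans (ler_norm _)); apply: (le_trans (psd_CS_sqrt L2_lin l2dot_psd hh hd)).
have le1 : l2norm Omega (h - psi) <= e / (l2norm Omega h + 1).
  by apply: le_trans (ltW phie); exact: (l2norm_le_H2norm (w - jet_of phi) i k).
have h0 : 0 <= l2norm Omega h by exact: sqrtr_ge0.
apply: (le_trans (ler_wpM2l (sqrtr_ge0 _) le1)).
rewrite -/(l2norm Omega h) mulrA ler_pdivrMr ?ltr_wpDl// mulrC ler_wpM2l// ?(ltW e0)//.
by rewrite lerDl.
Qed.

End SobolevForms.

(** * Mesh size under refinement *)

Section MeshSize.
Variable R : realType.
Implicit Types (t : triangle R) (T : set (triangle R)).

Lemma hull_newest t : hull t (newest t).
Proof.
exists 1, 0, 0; split=> //; first by rewrite !addr0.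
by rewrite scale1r !scale0r !addr0.
Qed.

Lemma hull_child t t' : children t t' -> hull t' `<=` hull t.
Proof.
(* The weight [a] of the midpoint is split equally between [vert1] and [vert2]. *)
case=> -> x [a [b [c [a0 b0 c0 abc ->]]]] /=;
  [exists b, (a / 2 + c), (a / 2) | exists b, (a / 2), (a / 2 + c)];
  (split; [lra|lra|lra|lra|]).
  by apply: injective_projections; rewrite /midpoint /= /GRing.scale /=; field.
  by apply: injective_projections; rewrite /midpoint /= /GRing.scale /=; field.
Qed.

Lemma refines_hull T T' : refines T T' ->
  forall t', T' t' -> exists2 t, T t & hull t' `<=` hull t.
Proof.
elim=> [t' Tt'|S t _ IH St t']; first by exists t'.
case=> [[/IH//]|/hull_child tt'].
have [s Ts ts] := IH _ St; exists s => //; exact: subset_trans tt' ts.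
Qed.

(** Makes the [sup] in [diam] meaningful: each coordinate on the hull is bounded by the sum of its
    absolute values at the vertices. *)
Lemma has_sup_diam t :
  has_sup [set d | exists x y, [/\ hull t x, hull t y & d = eucl_dist x y]].
Proof.
split.
  exists (eucl_dist (newest t) (newest t)), (newest t), (newest t).
  by split=> //; exact: hull_newest.
pose M (f : plane R -> R) := `|f (newest t)| + `|f (vert1 t)| + `|f (vert2 t)|.
have bnd (f : {linear plane R -> R}) x : hull t x -> `|f x| <= M f.
  move=> [a [b [c [a0 b0 c0 abc ->]]]]; rewrite !linearD !linearZ/=.
  have [a1 b1 c1] : [/\ a <= 1, b <= 1 & c <= 1] by split; lra.
  rewrite (le_trans (ler_normD _ _))// lerD//.
    rewrite (le_trans (ler_normD _ _))// lerD// normrM ger0_norm//.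
      by rewrite ler_piMl.
    by rewrite ler_piMl.
  by rewrite normrM ger0_norm// ler_piMl.
exists (Num.sqrt ((2 * M fst) ^+ 2 + (2 * M snd) ^+ 2)) => _ [x [y [hx hy ->]]].
have K (f : {linear plane R -> R}) : (f x - f y) ^+ 2 <= (2 * M f) ^+ 2.
  have := bnd f x hx; have := bnd f y hy.
  rewrite !ler_norml => /andP[? ?] /andP[? ?].
  have p1 : 0 <= 2 * M f - (f x - f y) by lra.
  have p2 : 0 <= 2 * M f + (f x - f y) by lra.
  by rewrite -subr_ge0 subr_sqr mulr_ge0.
by rewrite ler_wsqrtr// lerD// K.
Qed.

Lemma diamS t t' : hull t' `<=` hull t -> diam (hull t') <= diam (hull t).
Proof.
move=> tt'; apply: sup_le; last exact: has_sup_diam.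
  move=> d [x [y [hx hy ->]]]; apply: le_down.
  by exists x, y; split=> //; exact: tt'.
by have [] := has_sup_diam t'.
Qed.

Lemma finite_has_ubound (A : set R) : finite_set A -> has_ubound A.
Proof.
move=> /finite_seqP[s ->]; elim: s => [|x s [M hM]]; first by exists 0.
exists (Num.max x M) => y /=; rewrite inE => /predU1P[->|ys].
  by rewrite le_max lexx.
by rewrite le_max [X in _ || X]hM ?orbT.
Qed.

(** Every refined triangle lies in a coarse one. This makes the properties assumed up to mesh size
    [delta2] available on the refinement. *)
Lemma refines_hmax T T' delta : finite_set T -> 0 <= delta -> refines T T' ->
  hmax T <= delta -> hmax T' <= delta.
Proof.
move=> fT d0 TT' hT.
(* The supremum of the empty set is 0, hence the sign condition on [delta]. *)
have [[d0' Td0']|] := pselect ([set diam (hull t) | t in T'] !=set0); last first.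
  by move=> /nonemptyPn; rewrite /hmax => ->; rewrite sup0.
apply: ge_sup; first by exists d0'.
move=> _ [t' Tt' <-]; have [t Tt tt'] := refines_hull TT' Tt'.
apply: le_trans hT; apply: (le_trans (diamS tt')).
apply: ub_le_sup; last by exists t.
by apply: finite_has_ubound; exact: finite_image.
Qed.

End MeshSize.

(** * Discrete eigenvalues *)

Section DiscreteEigenvalues.
Variables (R : realType) (Omega : set (plane R)).
Hypotheses (oOmega : open Omega) (bOmega : bounded_set Omega).

Let formb_psd := formb_psd oOmega.
Let forma_psd := forma_psd oOmega.
Let jet2_lin := jet2_lin oOmega.

Lemma linear_subspace_closed W : linear_subspace Omega W -> lin_closed W.
Proof. by case. Qed.

Lemma linear_subspace_jet2 W : linear_subspace Omega W -> W `<=` jet2 Omega.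
Proof. by case=> WH _ _ w /WH; exact: H20_jet2. Qed.

Lemma linear_subspace_null W : linear_subspace Omega W ->
  null_dominated (forma Omega) (formb Omega) W.
Proof. by case=> WH _ _ w /WH; exact: H20_null. Qed.

Lemma has_dim_span W n : W `<=` jet2 Omega -> has_dim Omega W n ->
  exists e : 'I_n -> jet R, [/\ forall i, W (e i),
    free_family (formb Omega) e & spans (formb Omega) W e].
Proof.
move=> WH [e [We fe se]]; exists e.
have Hc (c : 'I_n -> R) : jet2 Omega (\sum_m c m *: e m).
  by apply: lin_closed_comb => // i; exact: WH.
split=> // [c c0|w Ww].
  apply: fe; apply/(aeeqP oOmega (Hc c) (lin_closed0 jet2_lin)).
  by rewrite subr0.
have [c hc] := se _ Ww; exists c.
by apply/(aeeqP oOmega (WH _ Ww) (Hc c)).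
Qed.

(** The bijection counting the multiplicity of each eigenvalue provides the injections for
    [exists_eigenbasis]. Eigenvalues are numbered from 1, ordinals from 0. *)
Lemma spectrum_eigenbasis W n l : linear_subspace Omega W ->
  has_dim Omega W n -> spectrum Omega W [set k | (1 <= k <= n)%N] l ->
  exists f : 'I_n -> jet R,
    eigenbasis (forma Omega) (formb Omega) W (fun i => l i.+1) f.
Proof.
move=> sW dW [_ _ hl].
have WH := linear_subspace_jet2 sW; have hW := linear_subspace_closed sW.
have [e [We _ se]] := has_dim_span WH dW.
apply: (exists_eigenbasis jet2_lin forma_psd formb_psd hW WH We se) => m.
have [p dp /card_set_bijP[h [hp hinj _]]] := hl m.
have EH : eigspace Omega W m `<=` jet2 Omega by move=> w [/WH].
have [g [gm fg _]] := has_dim_span EH dp.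
exists p, g; first by split.
exists (fun i => h i.+1); split=> [i lim|i k lim lkm hik].
  by apply: hp; split=> //=; rewrite ltn_ord.
apply/val_inj/succn_inj; apply: hinj hik; rewrite inE; split=> //=; exact: ltn_ord.
Qed.

End DiscreteEigenvalues.

(** Provides the gap hypothesis of [ritz_estimate] for [m] between [lam j] and [l j]. Below [j] the
    quotient m/(m - l k) is largest at m = [lam j], above [j] the quotient m/(l k - m) is largest at
    m = [l j]; the neighbours of [j] are the worst k. *)
Lemma separation_bound (R : realType) (lam l : nat -> R) (n j k : nat) (m s : R) :
  let lh := ext_eigenvalue n l in
  (1 <= j <= n)%N -> (forall i, (1 <= i <= n)%N -> 0 < l i) ->
  (forall i i', (1 <= i <= n)%N -> (1 <= i' <= n)%N -> (i <= i')%N -> l i <= l i') ->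
  (lh j.-1 < (lam j)%:E)%E -> (lh j < (lam j.+1)%:E)%E ->
  ((lam j.+1)%:E <= lh j.+1)%E -> (separation lam lh j <= s%:E)%E ->
  0 < lam j -> lam j <= m -> m <= l j ->
  (1 <= k <= n)%N -> k != j -> l k != l j /\ m <= s * `|l k - m|.
Proof.
move=> lh hj l_gt0 lmono h1 h2 h3 sep lam_gt0 lm ml hk.
have lhE i : (1 <= i <= n)%N -> lh i = (l i)%:E.
  by rewrite /lh /ext_eigenvalue => /andP[i0 ->]; rewrite gtn_eqF.
move: sep; rewrite /separation ge_max => /andP[s1 s2].
rewrite neq_ltn => /orP[kj|jk].
  (* Since 1 <= k < j, the convention for eigenvalue number 0 does not interfere. *)
  have hj1 : (1 <= j.-1 <= n)%N by lia.
  rewrite lhE// lte_fin in h1.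
  have lk1 : l k <= l j.-1 by apply: lmono => //; lia.
  have lj0 := l_gt0 _ hj1.
  have d0 : 0 < lam j - l j.-1 by rewrite subr_gt0.
  move: s1; rewrite lhE// -EFinB inver gt_eqF// -EFinM lee_fin ler_pdivrMr// => s1.
  split; first by rewrite lt_eqF//; lra.
  rewrite ltr0_norm; last lra.
  (* The numerator [lam j] exceeds the denominator, so [s >= 1], and raising [lam j] to [m] adds at
     least as much on the right as on the left. *)
  have s_ge1 : 1 <= s by rewrite -(ler_pM2r d0); lra.
  nra.
have hj1 : (1 <= j.+1 <= n)%N by lia.
rewrite lhE// in h2; rewrite lhE// in h3; rewrite lte_fin in h2; rewrite lee_fin in h3.
have lk1 : l j.+1 <= l k by apply: lmono => //; lia.
have d0 : 0 < l j.+1 - l j by rewrite subr_gt0; lra.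
move: s2; rewrite !lhE// -EFinB inver gt_eqF// -EFinM lee_fin ler_pdivrMr// => s2.
split; first by rewrite gt_eqF//; lra.
rewrite gtr0_norm; last lra.
have lj0 := l_gt0 _ hj.
have s_ge0 : 0 < s by rewrite -(ltr_pM2r d0) mul0r; lra.
nra.
Qed.

(** * The stability estimate *)

Theorem lemma2p1 (R : realType) (Omega : set (plane R))
    (T0 : set (triangle R)) (sigma Capx delta2 Lsep : R)
    (hOmega : polygonal_lipschitz_domain Omega)
    (hT0 : regular_triangulation Omega T0)
    (hsigma : exists2 sreg : R, 2^-1 < sreg & sigma = Num.min 1 sreg)
    (hreg : elliptic_regularity Omega sigma)
    (hdelta2 : 0 < delta2) (hLsep : 0 < Lsep) :
  exists2 Lstab : R, 0 < Lstab &
  forall (V : set (triangle R) -> set (jet R)) (N : set (triangle R) -> nat)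
    (hV : discrete_spaces Omega T0 sigma Capx V N)
    (lam : nat -> R) (hlam0 : lam 0%N = 0)
    (hlam : spectrum Omega (H20 Omega) [set k | (1 <= k)%N] lam)
    (hlamoo : lam k @[k --> \oo] --> +oo)
    (j : nat) (hj : (1 <= j)%N)
    (hsimple : has_dim Omega (eigspace Omega (H20 Omega) (lam j)) 1)
    (u : jet R) (hu : unit_eigenvector Omega (H20 Omega) (lam j) u)
    (l : set (triangle R) -> nat -> R)
    (hl : forall T, triangulations Omega T0 T ->
      spectrum Omega (V T) [set k | (1 <= k <= N T)%N] (l T))
    (uh : set (triangle R) -> jet R)
    (huh : forall T, triangulations Omega T0 T -> (j <= N T)%N ->
      unit_eigenvector Omega (V T) (l T j) (uh T) /\ 0 <= formb Omega u (uh T))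
    (Lqo : R) (hLqo : 0 < Lqo)
    (hi : forall T, triangulations_upto Omega T0 delta2 T ->
      (j <= N T)%N /\
      LB Omega (lam j) (l T j) u (uh T) <=
        Lqo * best_approx Omega (V T) u ^+ 2)
    (hii : forall T, triangulations_upto Omega T0 delta2 T ->
      LB Omega (lam j) (l T j) u (uh T) < 2^-1)
    (hiii : forall T, triangulations_upto Omega T0 delta2 T ->
      let lh := ext_eigenvalue (N T) (l T) in
      [/\ ((lam j.-1)%:E <= lh j.-1)%E, (lh j.-1 < (lam j)%:E)%E,
          ((lam j)%:E <= lh j)%E, (lh j < (lam j.+1)%:E)%E
        & ((lam j.+1)%:E <= lh j.+1)%E])
    (hiv : forall T, triangulations_upto Omega T0 delta2 T ->
      (separation lam (ext_eigenvalue (N T) (l T)) j <= Lsep%:E)%E),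
  forall T T' : set (triangle R), triangulations_upto Omega T0 delta2 T ->
    triangulations Omega T0 T' -> refines T T' ->
    bnorm Omega (uh T' - uh T) <=
      Lstab * hmax T `^ sigma * enorm Omega (uh T' - uh T).
Proof.
have [oO _ _ bO _] := hOmega.
have [Creg hCreg] := hreg.
have aP := forma_psd oO; have bP := formb_psd oO; have JL := jet2_lin oO.
have finT T : triangulations Omega T0 T -> finite_set T by case=> _ [].
(* The first factor comes from [ritz_estimate], the second from duality. Absolute values cover
   constants of either sign, and adding 1 makes the final constant positive. *)
pose K := 2 * (1 + Lsep) * (`|Capx| * `|Creg|).
have K_ge0 : 0 <= K by rewrite !mulr_ge0// addr_ge0// ltW.
exists (K + 1); first by rewrite ltr_wpDl.
move=> V N [hV hnest happ] lam _ [lam_gt0 _ _] _ j hj _ u [[Hu _] u1] l hl uh huh.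
move=> Lqo _ hi hii hiii hiv T T' hT hT' TT'.
have [tT hmT] := hT.
have hTu' : triangulations_upto Omega T0 delta2 T'.
  by split=> //; apply: refines_hmax TT' hmT => //; [exact: finT|exact: ltW].
have [[sW dW] [sW' dW']] := (hV _ tT, hV _ hT').
have [hW hW'] := (linear_subspace_closed sW, linear_subspace_closed sW').
have [WH WH'] := (linear_subspace_jet2 sW, linear_subspace_jet2 sW').
have W0' := linear_subspace_null oO bO sW'.
have WW' := hnest _ _ tT hT' TT'.
have [jN _] := hi _ hT; have [jN' _] := hi _ hTu'.
have [[euh uh1] _] := huh _ tT jN; have [[euh' uh1'] _] := huh _ hT' jN'.
have [l_gt0 lmono _] := hl _ tT; have [l_gt0' lmono' _] := hl _ hT'.
have [f hf] := spectrum_eigenbasis oO sW dW (hl _ tT).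
have [f' hf'] := spectrum_eigenbasis oO sW' dW' (hl _ hT').
have jlt : (j.-1 < N T)%N by rewrite prednK.
have jlt' : (j.-1 < N T')%N by rewrite prednK.
have ll : l T' j <= l T j.
  have := @eigenvalue_mono _ _ _ _ _ JL aP bP _ _ _ _ _ _ f f' (Ordinal jlt)
    (Ordinal jlt') hW hW' WW' WH' W0' hf hf'.
  rewrite /= prednK//; apply=> // i k ik.
    by apply: lmono => //=; exact: ltn_ord.
  by apply: lmono' => //=; exact: ltn_ord.
(* The other contributions to [LB] are nonnegative, so its bound 1/2 passes to the squared L2
   distance. *)
have extE S : triangulations_upto Omega T0 delta2 S ->
    lam j <= l S j /\ bnorm Omega (u - uh S) ^+ 2 < 2^-1.
  move=> hS; have [_ _] := hiii _ hS; have [jS _] := hi _ hS.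
  rewrite /ext_eigenvalue gtn_eqF// jS lee_fin => lamS _ _; split=> //.
  have := hii _ hS; rewrite /LB; have := sqr_ge0 (enorm Omega (u - uh S)); lra.
have [lamT bT] := extE _ hT; have [lamT' bT'] := extE _ hTu'.
have sqb w : jet2 Omega w -> bnorm Omega w ^+ 2 = formb Omega w w.
  by move=> hw; rewrite sqr_sqrtr//; exact: (psd_ge0 bP).
have [Wuh Wuh'] : V T (uh T) /\ V T' (uh T') by case: euh; case: euh'.
have [Huh Huh'] := (WH _ Wuh, WH' _ Wuh').
have hu := H20_jet2 Hu.
have b1 : formb Omega (uh T) (uh T) = 1 by rewrite -sqb// uh1 expr1n.
have b1' : formb Omega (uh T') (uh T') = 1 by rewrite -sqb// uh1' expr1n.
(* Both discrete eigenvectors are close to [u], which fixes their relative sign. *)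
have bge0 : 0 <= formb Omega (uh T') (uh T).
  rewrite (sqb _ (lin_closedB JL hu Huh)) in bT.
  rewrite (sqb _ (lin_closedB JL hu Huh')) in bT'.
  exact: (psd_close_ge0 JL bP hu Huh' Huh b1' b1 bT' bT).
have lam_j0 : 0 < lam j by exact: lam_gt0.
have sep (i : 'I_(N T)) : i != Ordinal jlt ->
    l T i.+1 != l T j /\ l T' j <= Lsep * `|l T i.+1 - l T' j|.
  move=> ij; have [_ h1 _ h2 h3] := hiii _ hT.
  apply: (separation_bound _ _ _ h1 h2 h3 (hiv _ hT)) => //.
  - by rewrite hj.
  - by rewrite /= ltn_ord.
  - by rewrite -(prednK hj) eqSS.
have [g [Wg orth est]] := @ritz_estimate _ _ _ _ _ JL aP bP (V T) (V T') (N T)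
  (fun i => l T i.+1) f (Ordinal jlt) (l T' j) Lsep (uh T') (uh T) hW hW' WW' WH'
  W0' hf (fun i => l_gt0 i.+1 (ltn_ord i))
  ltac:(by move=> i ij; rewrite /= prednK//; have [] := sep i ij)
  ltac:(by apply: l_gt0'; rewrite /= hj) (ltW hLsep)
  ltac:(by move=> i ij; have [] := sep i ij)
  euh' b1' ltac:(by rewrite /= prednK) b1 bge0.
set e := uh T' - g in est orth.
have We : V T' e by apply: lin_closedB => //; exact: WW'.
have He := WH' _ We.
have H20e : H20 Omega e by case: sW' => h _ _; exact: h.
(* Dual problem with the projection error [e] as load. *)
have [z [Hz zE z2 zle]] := hCreg (jval e) He.1.
have hz := H20_jet2 Hz.
have dual : formb Omega e e <= best_approx Omega (V T) z * enorm Omega e.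
  have AN v : V T v -> formb Omega e e <= enorm Omega (z - v) * enorm Omega e.
    move=> Wv; apply: (aubin_nitsche JL aP WH He hz Wv orth); exact: zE.
  (* Passing to the infimum over [v] divides by the energy norm of [e]; if that vanishes, so does
     the L2 norm, by [AN]. *)
  have [e0|e0] := eqVneq (enorm Omega e) 0.
    by rewrite e0 mulr0; have := AN _ Wg; rewrite e0 mulr0.
  have e_gt0 : 0 < enorm Omega e by rewrite lt_def e0 sqrtr_ge0.
  rewrite -ler_pdivrMr//; apply: lb_le_inf.
    by exists (enorm Omega (z - g)), g.
  by move=> _ [v Wv <-]; rewrite ler_pdivrMr// AN.
set h := hmax T `^ sigma; have h_ge0 : 0 <= h by exact: powR_ge0.
have bestle : best_approx Omega (V T) z <= `|Capx| * `|Creg| * h * bnorm Omega e.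
  apply: (le_trans (happ _ _ tT Hz z2)); rewrite -/h.
  apply: (@le_trans _ _ (`|Capx| * h * H2s_norm Omega sigma z)).
    by rewrite ler_wpM2r ?sqrtr_ge0// ler_wpM2r// ler_norm.
  rewrite [leRHS](_ : _ = `|Capx| * h * (`|Creg| * bnorm Omega e)); last by ring.
  rewrite ler_wpM2l ?mulr_ge0//; apply: (le_trans zle).
  by rewrite ler_wpM2r ?sqrtr_ge0// ler_norm.
have ble : bnorm Omega e <= `|Capx| * `|Creg| * h * enorm Omega e.
  have [e0|e0] := eqVneq (bnorm Omega e) 0.
    by rewrite e0 !mulr_ge0// sqrtr_ge0.
  have e_gt0 : 0 < bnorm Omega e by rewrite lt_def e0 sqrtr_ge0.
  (* The duality bound contains one factor [bnorm Omega e] on the right, which cancels against the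
     square on the left. *)
  rewrite -(ler_pM2r e_gt0) -expr2 sqb//; apply: (le_trans dual).
  rewrite [leRHS]mulrAC; apply: ler_wpM2r => //; exact: sqrtr_ge0.
have ele : enorm Omega e <= enorm Omega (uh T' - uh T).
  by apply: ler_wsqrtr; exact: (galerkin_best JL aP hW WH Huh' Wg Wuh orth).
have en0 : 0 <= enorm Omega (uh T' - uh T) by exact: sqrtr_ge0.
apply: (le_trans est).
apply: (@le_trans _ _ (K * h * enorm Omega (uh T' - uh T))); last first.
  by rewrite ler_wpM2r// ler_wpM2r// lerDl.
rewrite /K -!mulrA ler_wpM2l// ler_wpM2l ?addr_ge0 ?(ltW hLsep)//.
rewrite !mulrA; apply: (le_trans ble); rewrite ler_wpM2l//.
by rewrite !mulr_ge0.
Qed.
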